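(* Let $N\geq 1$ be an integer. Then for all $0<|x|<\pi/2$, \[ a_N x^{2N+2}<2\left(\frac{x}{\sin x}\right)+\frac{x}{\tan x}-\left(3+\sum_{j=2}^{N}\frac{(2^{2j}-4)|B_{2j}|}{(2j)!}x^{2j}\right)<b_N x^{2N+2}, \] with the best possible constants \[ a_N=\frac{(2^{2N+2}-4)|B_{2N+2}|}{(2N+2)!}, \] \[ b_N=\frac{8}{\pi^{2N+2}}\left(\sum_{k=1}^{\infty}\frac{(-1)^{k+1}}{k^{2N}(2k-1)}-\sum_{k=1}^{\infty}\frac{(-1)^{k+1}}{k^{2N}(2k+1)}\right)-\frac{4}{\pi^{2N+2}}\left(\sum_{k=1}^{\infty}\frac{1}{k^{2N}(2k-1)}-\sum_{k=1}^{\infty}\frac{1}{k^{2N}(2k+1)}\right). \]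
   Context: The Bernoulli numbers $B_n$ are defined by $\frac{t}{e^t-1}=\sum_{n=0}^\infty B_n\frac{t^n}{n!}$ for $|t|<2\pi$. An empty sum is understood to be zero. *)

(* Defs.v *)
From Stdlib Require Import Reals Arith.
Open Scope R_scope.

(* B is a sequence of Bernoulli numbers: t/(e^t-1) = sum_n B_n t^n/n!
   for 0 < |t| < 2*pi (the value at t = 0 is the removable-singularity
   value 1, fixed by continuity; the punctured disc determines B uniquely). *)
Definition is_bernoulli (B : nat -> R) : Prop :=
  forall t : R, 0 < Rabs t < 2 * PI ->
    infinite_sum (fun n => B n * t ^ n / INR (fact n)) (t / (exp t - 1)).

Fixpoint sum_from2 (g : nat -> R) (n : nat) : R :=
  match n with
  | O => 0
  | S m => sum_from2 g m + (if Nat.leb 2 (S m) then g (S m) else 0)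
  end.

Definition coef (B : nat -> R) (j : nat) : R :=
  (2 ^ (2 * j)%nat - 4) * Rabs (B (2 * j)%nat) / INR (fact (2 * j)%nat).

Definition Fdiff (B : nat -> R) (N : nat) (x : R) : R :=
  2 * (x / sin x) + x / tan x - (3 + sum_from2 (fun j => coef B j * x ^ (2 * j)%nat) N).

(* Main.v *)
(** Integrating [cos (2 x t)] and [t sin (2 x t)] against [cos t ^ (2 m)] over
    [0, pi/2], Green's identity gives recurrences in [m] whose quotient telescopes to
    the partial fractions of [pi x cot (pi x)]; the same argument with hyperbolic
    functions gives those of [pi x coth (pi x)].  Both are [1 - 2 s poles 0 s], with
    [poles 0 s = sum_k 1 / (k^2 - s)] and [s = x^2], respectively [s = - x^2].
    Expanding [t / (e^t - 1) = (t/2) coth (t/2) - t/2] finitely at [0] identifies the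
    Bernoulli numbers with the values [poles J 0 = zeta (2 J + 2)].
    Since [x / sin x = 2 (x/2) cot (x/2) - x cot x], the function [Fdiff B N x] is
    [2 s^(N+1) (poles N s - 4^(-N) poles N (s/4))] with [s = (x/pi)^2].  The last factor
    is strictly increasing and Lipschitz on [0, 1/4], so the best constants are its
    values at the endpoints, up to the factor [2 / pi^(2 N + 2)]. *)

Require Import Defs.
From Stdlib Require Import Reals Arith Lra Lia.
From Coquelicot Require Import Coquelicot.
Open Scope R_scope.

(** * Integrals against even powers of the cosine *)

Definition wallis (D : R -> R) (m : nat) : R :=
  RInt (fun t => D t * cos t ^ (2 * m)) 0 (PI / 2).

Lemma continuous_mult_cos_pow (D : R -> R) (m : nat) (t : R) :
  continuous D t -> continuous (fun t => D t * cos t ^ m) t.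
Proof.
  intros HD. apply (continuous_mult D (fun t => cos t ^ m)); [exact HD|].
  apply (ex_derive_continuous (V := R_NormedModule)). auto_derive. trivial.
Qed.

Lemma is_RInt_wallis (D : R -> R) (m : nat) :
  (forall t, continuous D t) ->
  is_RInt (fun t => D t * cos t ^ (2 * m)) 0 (PI / 2) (wallis D m).
Proof.
  intros HD. apply (RInt_correct (V := R_CompleteNormedModule)), ex_RInt_continuous.
  intros t _. now apply continuous_mult_cos_pow.
Qed.

Lemma wallis_linear (a b : R) (D E : R -> R) (m : nat) :
  (forall t, continuous D t) -> (forall t, continuous E t) ->
  wallis (fun t => a * D t + b * E t) m = a * wallis D m + b * wallis E m.
Proof.
  intros HD HE. apply is_RInt_unique.
  apply (is_RInt_ext (fun t => plus (scal a (D t * cos t ^ (2 * m)))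
                                    (scal b (E t * cos t ^ (2 * m))))).
  - intros t _. unfold plus, scal; simpl; unfold mult; simpl. ring.
  - apply (is_RInt_plus (V := R_NormedModule));
      apply (is_RInt_scal (V := R_NormedModule)); now apply is_RInt_wallis.
Qed.

Lemma wallis_scal (a : R) (D : R -> R) (m : nat) :
  (forall t, continuous D t) -> wallis (fun t => a * D t) m = a * wallis D m.
Proof.
  intros HD. apply is_RInt_unique.
  apply (is_RInt_ext (fun t => scal a (D t * cos t ^ (2 * m)))).
  - intros t _. unfold scal; simpl; unfold mult; simpl. ring.
  - apply (is_RInt_scal (V := R_NormedModule)). now apply is_RInt_wallis.
Qed.

Lemma cos_pow_even_nonneg (t : R) (m : nat) : 0 <= cos t ^ (2 * m).
Proof. rewrite pow_mult. apply pow_le, pow2_ge_0. Qed.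

Lemma wallis_le (D E : R -> R) (m : nat) :
  (forall t, continuous D t) -> (forall t, continuous E t) ->
  (forall t, 0 <= t <= PI / 2 -> D t <= E t) -> wallis D m <= wallis E m.
Proof.
  intros HD HE Hle. pose proof PI_RGT_0.
  apply (is_RInt_le (fun t => D t * cos t ^ (2 * m)) (fun t => E t * cos t ^ (2 * m)) 0 (PI / 2)).
  - lra.
  - now apply is_RInt_wallis.
  - now apply is_RInt_wallis.
  - intros t Ht. apply Rmult_le_compat_r; [apply cos_pow_even_nonneg|]. apply Hle; lra.
Qed.

(* Green's identity for [D] and [cos ^ (2 m + 2)]. *)
Lemma wallis_step (D D1 D2 : R -> R) (m : nat) :
  (forall t, is_derive D t (D1 t)) -> (forall t, is_derive D1 t (D2 t)) ->
  (forall t, continuous D2 t) -> D1 0 = 0 ->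
  2 * (INR m + 1) * (2 * INR m + 1) * wallis D m =
  4 * (INR m + 1) ^ 2 * wallis D (S m) + wallis D2 (S m).
Proof.
  intros H1 H2 HD2 H0. set (r := INR m).
  assert (HD : forall t, continuous D t).
  { intros t. apply (ex_derive_continuous (V := R_NormedModule)). eexists; apply H1. }
  assert (Hint : is_RInt (fun t =>
     plus (scal (2 * (r + 1) * (2 * r + 1)) (D t * cos t ^ (2 * m)))
          (plus (scal (- (4 * (r + 1) ^ 2)) (D t * cos t ^ (2 * S m)))
                (scal (-1) (D2 t * cos t ^ (2 * S m))))) 0 (PI / 2)
     (plus (scal (2 * (r + 1) * (2 * r + 1)) (wallis D m))
          (plus (scal (- (4 * (r + 1) ^ 2)) (wallis D (S m)))
                (scal (-1) (wallis D2 (S m)))))).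
  { apply (is_RInt_plus (V := R_NormedModule));
      [|apply (is_RInt_plus (V := R_NormedModule))];
      apply (is_RInt_scal (V := R_NormedModule)); now apply is_RInt_wallis. }
  pose (A := fun t => D t * (- (2 * (r + 1)) * sin t * cos t ^ (2 * m + 1))
                      - D1 t * cos t ^ (2 * m + 2)).
  assert (HA : is_RInt (fun t =>
     plus (scal (2 * (r + 1) * (2 * r + 1)) (D t * cos t ^ (2 * m)))
          (plus (scal (- (4 * (r + 1) ^ 2)) (D t * cos t ^ (2 * S m)))
                (scal (-1) (D2 t * cos t ^ (2 * S m))))) 0 (PI / 2)
     (minus (A (PI / 2)) (A 0))).
  { apply (is_RInt_derive (V := R_CompleteNormedModule)).
    - intros t _.
      change (is_derive A t (2 * (r + 1) * (2 * r + 1) * (D t * cos t ^ (2 * m))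
        + (- (4 * (r + 1) ^ 2) * (D t * cos t ^ (2 * S m)) + -1 * (D2 t * cos t ^ (2 * S m))))).
      unfold A. auto_derive.
      + repeat split; [eexists; apply H1 | eexists; apply H2].
      + rewrite (is_derive_unique (fun x : R => D x) t (D1 t) (H1 t)),
          (is_derive_unique (fun x : R => D1 x) t (D2 t) (H2 t)).
        replace (2 * S m)%nat with (S (S (2 * m))) by lia.
        replace (m + (m + 0) + 1)%nat with (S (2 * m)) by lia.
        replace (m + (m + 0) + 2)%nat with (S (S (2 * m))) by lia.
        rewrite !S_INR, mult_INR. change (INR 2) with (1 + 1). fold r.
        rewrite !Nat.pred_succ, <- !tech_pow_Rmult.
        set (w := cos t ^ (2 * m)). clearbody w.
        pose proof (sin2_cos2 t) as E. unfold Rsqr in E.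
        assert (E' : sin t ^ 2 = 1 - cos t ^ 2) by (simpl; lra).
        ring_simplify. rewrite E'. ring.
    - intros t _. apply (continuous_plus (V := R_NormedModule));
        [|apply (continuous_plus (V := R_NormedModule))];
        apply (continuous_scal_r (V := R_NormedModule)); now apply continuous_mult_cos_pow. }
  pose proof (eq_trans (eq_sym (is_RInt_unique (V := R_CompleteNormedModule) _ _ _ _ Hint))
    (is_RInt_unique (V := R_CompleteNormedModule) _ _ _ _ HA)) as Heq.
  change (2 * (r + 1) * (2 * r + 1) * wallis D m
    + (- (4 * (r + 1) ^ 2) * wallis D (S m) + -1 * wallis D2 (S m)) = A (PI / 2) - A 0) in Heq.
  (* Both boundary terms vanish: a positive power of [cos (PI / 2) = 0] at the right end,
     [sin 0 = 0] and [D1 0 = 0] at the left end. *)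
  unfold A in Heq. rewrite cos_PI2, sin_0, H0, !pow_i in Heq by lia. lra.
Qed.

Lemma wallis_ext (D E : R -> R) (m n : nat) :
  (forall t : R, D t * cos t ^ (2 * m) = E t * cos t ^ (2 * n)) -> wallis D m = wallis E n.
Proof. intros H. apply RInt_ext. intros t _. apply H. Qed.

Lemma wallis_S (D : R -> R) (m : nat) :
  wallis D (S m) = wallis (fun t => D t * cos t ^ 2) m.
Proof.
  apply wallis_ext. intros t.
  replace (2 * S m)%nat with (2 + 2 * m)%nat by lia. rewrite pow_add. ring.
Qed.

Lemma continuous_of_is_derive (D D1 : R -> R) :
  (forall t, is_derive D t (D1 t)) -> forall t, continuous D t.
Proof.
  intros H t. apply (ex_derive_continuous (V := R_NormedModule)). eexists; apply H.
Qed.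

(** Green's identity with [D = 1]: the classical Wallis recurrence. It measures the gap between
    consecutive integrals, which later controls the tail of the telescoping sum. *)
Lemma wallis_one_step (m : nat) :
  (2 * INR m + 1) * wallis (fun _ => 1) m = 2 * (INR m + 1) * wallis (fun _ => 1) (S m).
Proof.
  pose proof (wallis_step (fun _ => 1) (fun _ => 0) (fun _ => 0) m
    (fun t => is_derive_const 1 t) (fun t => is_derive_const 0 t)
    (fun t => continuous_const 0 t) eq_refl) as H.
  pose proof (wallis_scal 0 (fun _ => 1) (S m) (fun t => continuous_const 1 t)) as H0.
  assert (E : wallis (fun _ => 0) (S m) = 0).
  { transitivity (wallis (fun _ => 0 * 1) (S m)).
    - apply wallis_ext. intros t. ring.
    - rewrite H0. ring. }
  rewrite E in H. pose proof (pos_INR m).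
  apply (Rmult_eq_reg_l (2 * (INR m + 1))); [|lra].
  rewrite <- Rmult_assoc, H. ring.
Qed.

Lemma wallis_one_pos (m : nat) : 0 < wallis (fun _ => 1) m.
Proof.
  induction m as [|m IH].
  - unfold wallis. rewrite (RInt_ext _ (fun _ => 1)) by (intros; simpl; ring).
    rewrite RInt_const. unfold scal; simpl; unfold mult; simpl.
    pose proof PI_RGT_0. lra.
  - pose proof (wallis_one_step m) as H. pose proof (pos_INR m).
    apply (Rmult_lt_reg_l (2 * (INR m + 1))); [lra|].
    rewrite <- H, Rmult_0_r. apply Rmult_lt_0_compat; lra.
Qed.

(** * Partial fractions from a telescoping quotient of integrals *)

(** [sin u - u * cos u] vanishes at [0] and has derivative [u * sin u >= 0]. Squared, the bound
    trades [t ^ 2 * cos t ^ 2] for [1 - cos t ^ 2], a difference of consecutive weights. *)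
Lemma mult_cos_le_sin (t : R) : 0 <= t <= PI / 2 -> 0 <= t * cos t <= sin t.
Proof.
  intros Ht. assert (Hc : 0 <= cos t) by (apply cos_ge_0; lra).
  split; [apply Rmult_le_pos; lra|].
  destruct (MVT_gen (fun u => sin u - u * cos u) 0 t (fun u => u * sin u)) as [u [Hu E]].
  - intros u _. auto_derive; [trivial|ring].
  - intros u _. apply derivable_continuous_pt. eexists. apply is_derive_Reals.
    auto_derive; [trivial|reflexivity].
  - rewrite Rmin_left, Rmax_right in Hu by lra.
    rewrite sin_0 in E.
    assert (0 <= sin u) by (apply sin_ge_0; lra).
    assert (0 <= u * sin u * (t - 0)) by (repeat apply Rmult_le_pos; lra). lra.
Qed.

(* With [e = 1] the pair [(C, S)] is [(cos 2xt, sin 2xt)], with [e = -1] it is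
   [(cosh 2xt, sinh 2xt)]. *)
Lemma is_series_wallis_ratio (C S : R -> R) (e x lo hi : R) :
  (forall t, is_derive C t (- (2 * e * x) * S t)) ->
  (forall t, is_derive S t (2 * x * C t)) ->
  S 0 = 0 -> 0 < x -> e * x ^ 2 < 1 -> 0 < lo ->
  (forall t, 0 <= t <= PI / 2 -> lo <= C t <= hi) ->
  is_series (fun k => x / (INR (Datatypes.S k) ^ 2 - e * x ^ 2))
    (wallis (fun t => t * S t) 0 / wallis C 0).
Proof.
  intros HC HS S0 Hx Hex Hlo Hb. pose proof PI_RGT_0 as Hpi.
  set (K := wallis C). set (L := wallis (fun t => t * S t)). set (J := wallis (fun _ => 1)).
  pose proof (continuous_of_is_derive _ _ HC) as cC.
  pose proof (continuous_of_is_derive _ _ HS) as cS.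
  assert (HL1 : forall t, is_derive (fun t => t * S t) t (S t + 2 * x * (t * C t))).
  { intros t. auto_derive; [eexists; apply HS|].
    rewrite (is_derive_unique (fun x : R => S x) t _ (HS t)). ring. }
  assert (HL2 : forall t, is_derive (fun t => S t + 2 * x * (t * C t)) t
                  (4 * x * C t + - (4 * e * x ^ 2) * (t * S t))).
  { intros t. auto_derive; [split; [eexists; apply HS|split;[eexists; apply HC|trivial]]|].
    rewrite (is_derive_unique (fun x : R => S x) t _ (HS t)),
      (is_derive_unique (fun x : R => C x) t _ (HC t)). ring. }
  pose proof (continuous_of_is_derive _ _ HL1) as cL.
  assert (HK2 : forall t, is_derive (fun t => - (2 * e * x) * S t) t (- (4 * e * x ^ 2) * C t)).
  { intros t. auto_derive; [eexists; apply HS|].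
    rewrite (is_derive_unique (fun x : R => S x) t _ (HS t)). ring. }
  (* Since [C'' = - 4 e x^2 C] and [(t S)'' = 4 x C - 4 e x^2 t S], Green's identity closes on [K],
     and closes on [L] up to a source term in [K]. *)
  assert (Kstep : forall n, 2 * (INR n + 1) * (2 * INR n + 1) * K n
                   = 4 * ((INR n + 1) ^ 2 - e * x ^ 2) * K (Datatypes.S n)).
  { intros n. unfold K.
    rewrite (wallis_step C _ (fun t : R => - (4 * e * x ^ 2) * C t) n HC HK2).
    - rewrite wallis_scal by exact cC. ring.
    - intros t. apply (continuous_scal_r (V := R_NormedModule)), cC.
    - rewrite S0. ring. }
  assert (Lstep : forall n, 2 * (INR n + 1) * (2 * INR n + 1) * L n
                   = 4 * ((INR n + 1) ^ 2 - e * x ^ 2) * L (Datatypes.S n)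
                     + 4 * x * K (Datatypes.S n)).
  { intros n. unfold K, L.
    rewrite (wallis_step (fun t : R => t * S t) _
      (fun t : R => 4 * x * C t + - (4 * e * x ^ 2) * (t * S t)) n HL1 HL2).
    - rewrite wallis_linear by assumption. ring.
    - intros t. apply (continuous_plus (V := R_NormedModule));
        apply (continuous_scal_r (V := R_NormedModule)); [apply cC|apply cL].
    - rewrite S0. ring. }
  assert (HJ : forall n, 0 < J n) by (intros; apply wallis_one_pos).
  assert (KJ : forall n, lo * J n <= K n).
  { intros n. unfold J, K. rewrite <- wallis_scal by (intros; apply continuous_const).
    apply wallis_le; [intros; apply continuous_const|exact cC|].
    intros t Ht. specialize (Hb t Ht). lra. }
  assert (Kpos : forall n, 0 < K n).
  { intros n. pose proof (KJ n). pose proof (Rmult_lt_0_compat _ _ Hlo (HJ n)). lra. }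
  assert (Sb : forall t, 0 <= t <= PI / 2 -> 0 <= S t <= 2 * x * hi * t).
  { intros t Ht. destruct (MVT_gen S 0 t (fun u => 2 * x * C u)) as [u [Hu E]].
    - intros u _. apply HS.
    - intros u _. apply continuity_pt_filterlim, cS.
    - rewrite Rmin_left, Rmax_right in Hu by lra. rewrite S0, !Rminus_0_r in E.
      rewrite E. destruct (Hb u) as [Hb1 Hb2]; [lra|]. split.
      + repeat apply Rmult_le_pos; lra.
      + apply Rmult_le_compat_r; [lra|]. apply Rmult_le_compat_l; lra. }
  (* One factor [cos t ^ 2] is moved from the weight into the integrand; then [t S cos^2 <= 2 x hi
     (t cos t)^2 <= 2 x hi (1 - cos^2)]. *)
  assert (Lb : forall n, 0 <= L (Datatypes.S n) <= 2 * x * hi * (J n - J (Datatypes.S n))).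
  { intros n. unfold L, J. rewrite !wallis_S.
    assert (cc : forall t, continuous (fun t => t * S t * cos t ^ 2) t)
      by (intros; now apply (continuous_mult_cos_pow (fun t => t * S t))).
    assert (c1 : forall t : R, continuous (fun _ => 1) t) by (intros; apply continuous_const).
    assert (c2 : forall t, continuous (fun t => 1 * cos t ^ 2) t)
      by (intros; now apply (continuous_mult_cos_pow (fun t => 1))).
    split.
    - rewrite <- (Rmult_0_l (wallis (fun _ => 1) n)), <- wallis_scal by exact c1.
      apply wallis_le; [intros; apply continuous_const|exact cc|].
      intros t Ht. rewrite Rmult_0_l. apply Rmult_le_pos; [|apply pow2_ge_0].
      apply Rmult_le_pos; [lra|]. now apply Sb.
    - replace (2 * x * hi * _) with (2 * x * hi * wallis (fun _ => 1) n
        + - (2 * x * hi) * wallis (fun t => 1 * cos t ^ 2) n) by ring.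
      rewrite <- wallis_linear by assumption. apply wallis_le; [exact cc| |].
      + intros t. apply (continuous_plus (V := R_NormedModule));
          apply (continuous_scal_r (V := R_NormedModule)); [apply c1|apply c2].
      + intros t Ht. pose proof (mult_cos_le_sin t Ht) as Hs.
        pose proof (Sb t Ht) as HSt.
        assert (Hsq : (t * cos t) ^ 2 <= sin t ^ 2) by (apply pow_incr; lra).
        assert (sin t ^ 2 = 1 - cos t ^ 2)
          by (pose proof (sin2_cos2 t) as E; unfold Rsqr in E; simpl; lra).
        assert (Hhi : 0 <= 2 * x * hi).
        { specialize (Hb t Ht). apply Rmult_le_pos; lra. }
        assert (t * S t * cos t ^ 2 <= 2 * x * hi * (t * cos t) ^ 2).
        { replace (2 * x * hi * (t * cos t) ^ 2) with (t * (2 * x * hi * t) * cos t ^ 2) by ring.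
          apply Rmult_le_compat_r; [apply pow2_ge_0|]. apply Rmult_le_compat_l; lra. }
        assert (2 * x * hi * (t * cos t) ^ 2 <= 2 * x * hi * sin t ^ 2)
          by (apply Rmult_le_compat_l; lra).
        nra. }
  assert (Den : forall n, 0 < (INR n + 1) ^ 2 - e * x ^ 2).
  { intros n. pose proof (pos_INR n). nra. }
  (* Dividing the recurrence of [L] by that of [K] shows that each term of the series is a
     difference of consecutive quotients [L / K]. *)
  assert (Hsum : forall n, sum_n (fun k => x / (INR (Datatypes.S k) ^ 2 - e * x ^ 2)) n
                   = L 0%nat / K 0%nat - L (Datatypes.S n) / K (Datatypes.S n)).
  { assert (Hd : forall n, x / (INR (Datatypes.S n) ^ 2 - e * x ^ 2)
                   = L n / K n - L (Datatypes.S n) / K (Datatypes.S n)).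
    { intros n. rewrite S_INR. specialize (Kstep n). specialize (Lstep n).
      pose proof (Den n). pose proof (Kpos n). pose proof (Kpos (Datatypes.S n)).
      pose proof (pos_INR n).
      set (q := 2 * (INR n + 1) * (2 * INR n + 1)) in *.
      assert (0 < q) by (unfold q; nra).
      replace (L n / K n) with ((q * L n) / (q * K n)) by (field; lra).
      rewrite Lstep, Kstep. field. lra. }
    induction n as [|n IH].
    - rewrite sum_O. apply Hd.
    - rewrite sum_Sn, IH. unfold plus; simpl plus. rewrite Hd. simpl. ring. }
  (* The numerator is at most [2 x hi] times a Wallis gap, which is [J (n + 1) / (2 n + 1)]; the
     denominator is at least [lo * J (n + 1)]. The quotient is therefore [O(1 / n)]. *)
  assert (Lim : is_lim_seq (fun n => L (Datatypes.S n) / K (Datatypes.S n)) 0).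
  { apply (is_lim_seq_le_le (fun _ => 0) _ (fun n => 2 * x * hi / lo * / INR (Datatypes.S n))).
    - intros n. pose proof (Lb n) as Ln. pose proof (Kpos (Datatypes.S n)) as Kn.
      pose proof (KJ (Datatypes.S n)) as KJn. pose proof (HJ (Datatypes.S n)) as Jn.
      pose proof (wallis_one_step n) as Js. fold J in Js. pose proof (pos_INR n) as Pn.
      rewrite S_INR.
      assert (Hhi : 0 <= 2 * x * hi) by (specialize (Hb 0); apply Rmult_le_pos; lra).
      assert (EJ : J n - J (Datatypes.S n) = J (Datatypes.S n) / (2 * INR n + 1)).
      { apply (Rmult_eq_reg_l (2 * INR n + 1)); [|lra].
        rewrite Rmult_minus_distr_l, Js. field. lra. }
      split.
      + apply Rdiv_le_0_compat; lra.
      + apply Rle_div_l; [exact Kn|]. apply (Rle_trans _ _ _ (proj2 Ln)). rewrite EJ.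
        apply (Rle_trans _ (2 * x * hi / lo * / (INR n + 1) * (lo * J (Datatypes.S n)))).
        * replace (_ * (lo * _)) with (2 * x * hi * (J (Datatypes.S n) / (INR n + 1)))
            by (field; lra).
          apply Rmult_le_compat_l; [lra|]. apply Rmult_le_compat_l; [lra|].
          apply Rinv_le_contravar; lra.
        * apply Rmult_le_compat_l; [|lra]. apply Rmult_le_pos.
          -- apply Rdiv_le_0_compat; lra.
          -- apply Rlt_le, Rinv_0_lt_compat. lra.
    - apply is_lim_seq_const.
    - replace (Finite 0) with (Rbar_mult (2 * x * hi / lo) 0) by (simpl; f_equal; ring).
      apply is_lim_seq_scal_l.
      apply (is_lim_seq_incr_1 (fun n => / INR n)).
      apply (is_lim_seq_inv INR p_infty); [apply is_lim_seq_INR|easy]. }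
  change (is_lim_seq (sum_n (fun k => x / (INR (Datatypes.S k) ^ 2 - e * x ^ 2)))
    (Finite (L 0%nat / K 0%nat))).
  apply (is_lim_seq_ext (fun n => L 0%nat / K 0%nat - L (Datatypes.S n) / K (Datatypes.S n))).
  - intros n. now rewrite Hsum.
  - replace (Finite _) with (Finite (L 0%nat / K 0%nat - 0)) by (f_equal; ring).
    apply is_lim_seq_minus'; [apply is_lim_seq_const|exact Lim].
Qed.

(** For [m = 0] the weight is [1], so both integrals of the quotient are elementary; the sum is then
    divided by [x]. *)
Lemma is_series_partial_fractions (C S : R -> R) (e x lo hi : R) :
  e * e = 1 ->
  (forall t, is_derive C t (- (2 * e * x) * S t)) ->
  (forall t, is_derive S t (2 * x * C t)) ->
  S 0 = 0 -> 0 < x -> e * x ^ 2 < 1 -> 0 < lo ->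
  (forall t, 0 <= t <= PI / 2 -> lo <= C t <= hi) -> 0 < S (PI / 2) ->
  is_series (fun k => / (INR (Datatypes.S k) ^ 2 - e * x ^ 2))
    ((1 - PI * x * C (PI / 2) / S (PI / 2)) / (2 * (e * x ^ 2))).
Proof.
  intros He HC HS S0 Hx Hex Hlo Hb Hpos.
  pose proof (continuous_of_is_derive _ _ HC) as cC.
  pose proof (continuous_of_is_derive _ _ HS) as cS.
  assert (EK : wallis C 0 = S (PI / 2) / (2 * x)).
  { unfold wallis.
    assert (H : is_RInt (fun t => C t * cos t ^ (2 * 0)) 0 (PI / 2)
              (minus (/ (2 * x) * S (PI / 2)) (/ (2 * x) * S 0))).
    { apply (is_RInt_derive (V := R_CompleteNormedModule) (fun t => / (2 * x) * S t)).
      - intros t _. auto_derive; [eexists; apply HS|].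
        rewrite (is_derive_unique (fun x : R => S x) t _ (HS t)). simpl. field. lra.
      - intros t _. apply continuous_mult_cos_pow, cC. }
    rewrite (is_RInt_unique (V := R_CompleteNormedModule) _ _ _ _ H), S0.
    unfold minus, plus, opp; simpl. field. lra. }
  assert (EL : wallis (fun t => t * S t) 0
             = e * (S (PI / 2) / (4 * x ^ 2) - PI / 2 * C (PI / 2) / (2 * x))).
  { unfold wallis.
    (* Antiderivative of [t * S t] by parts; because [e * e = 1], the factor [e] serves as
       [1 / e]. *)
    pose (A := fun t => e * (S t / (4 * x ^ 2) - t * C t / (2 * x))).
    assert (H : is_RInt (fun t => t * S t * cos t ^ (2 * 0)) 0 (PI / 2)
              (minus (A (PI / 2)) (A 0))).
    { apply (is_RInt_derive (V := R_CompleteNormedModule) A).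
      - intros t _. unfold A. auto_derive.
        + split; [eexists; apply HS|]. split; [eexists; apply HC|trivial].
        + rewrite (is_derive_unique (fun x : R => S x) t _ (HS t)),
            (is_derive_unique (fun x : R => C x) t _ (HC t)). simpl.
          transitivity ((e * e) * (t * S t)); [field; lra|rewrite He; ring].
      - intros t _. apply (continuous_mult_cos_pow (fun t => t * S t)).
        apply (continuous_mult (fun t => t) S); [apply continuous_id|apply cS]. }
    rewrite (is_RInt_unique (V := R_CompleteNormedModule) _ _ _ _ H). unfold A. rewrite S0.
    unfold minus, plus, opp; simpl. field. lra. }
  pose proof (is_series_wallis_ratio C S e x lo hi HC HS S0 Hx Hex Hlo Hb) as H.
  rewrite EK, EL in H.
  apply (is_series_scal (/ x)) in H.
  assert (e <> 0) by (intros ->; lra).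
  replace ((1 - PI * x * C (PI / 2) / S (PI / 2)) / (2 * (e * x ^ 2))) with
    (scal (/ x) (e * (S (PI / 2) / (4 * x ^ 2) - PI / 2 * C (PI / 2) / (2 * x)) /
          (S (PI / 2) / (2 * x)))).
  - revert H. apply is_series_ext. intros k.
    assert (0 < INR (Datatypes.S k) ^ 2 - e * x ^ 2).
    { rewrite S_INR. pose proof (pos_INR k). nra. }
    unfold scal; simpl; unfold mult; simpl. field. simpl in *. split; lra.
  - unfold scal; simpl; unfold mult; simpl.
    transitivity (e * e * (1 - PI * x * C (PI / 2) / S (PI / 2)) / (2 * (e * (x * (x * 1))))); [field; lra|].
    rewrite He. field. lra.
Qed.

(* With this [N]-dependent weight, [poles N s] is the remainder of the geometric
   expansion of [poles 0 s], divided by [s ^ N]. *)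
Definition pole (N : nat) (s : R) (k : nat) : R :=
  / (INR (S k) ^ (2 * N) * (INR (S k) ^ 2 - s)).

Definition poles (N : nat) (s : R) : R := Series (pole N s).

(** * Partial fractions of the cotangent and hyperbolic cotangent *)

(** Case [e = 1], [x = y / PI]. For [y < PI / 2], [cos (2 x t)] stays above [cos y > 0] on the
    interval of integration, which is the positive lower bound required. *)
Lemma cot_partial_fractions (y : R) : 0 < y < PI / 2 ->
  y / tan y = 1 - 2 * (y / PI) ^ 2 * poles 0 ((y / PI) ^ 2).
Proof.
  intros Hy. set (x := y / PI). pose proof PI_RGT_0 as Hpi.
  assert (Hx : 0 < x < 1 / 2).
  { unfold x. split; [apply Rdiv_lt_0_compat; lra|]. apply Rlt_div_l; lra. }
  assert (E2 : 2 * x * (PI / 2) = y) by (unfold x; field; lra).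
  assert (Hc : 0 < cos y) by (apply cos_gt_0; lra).
  assert (Hs : 0 < sin y) by (apply sin_gt_0; lra).
  assert (H : is_series (fun k => / (INR (S k) ^ 2 - 1 * x ^ 2))
    ((1 - PI * x * cos (2 * x * (PI / 2)) / sin (2 * x * (PI / 2))) / (2 * (1 * x ^ 2)))).
  { apply (is_series_partial_fractions (fun t => cos (2 * x * t)) (fun t => sin (2 * x * t))
             1 x (cos y) 1); try lra.
    - intros t. auto_derive; [trivial|ring].
    - intros t. auto_derive; [trivial|ring].
    - rewrite Rmult_0_r. apply sin_0.
    - simpl; nra.
    - intros t Ht. assert (2 * x * t <= 2 * x * (PI / 2)) by (apply Rmult_le_compat_l; lra).
      assert (0 <= 2 * x * t) by (apply Rmult_le_pos; lra).
      split; [|apply COS_bound]. apply cos_decr_1; lra.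
    - rewrite E2. exact Hs. }
  rewrite E2 in H. unfold poles.
  rewrite (Series_ext _ (fun k => / (INR (S k) ^ 2 - 1 * x ^ 2))).
  - rewrite (is_series_unique _ _ H). unfold tan.
    replace (PI * x) with y by (unfold x; field; lra). simpl. field. lra.
  - intros k. unfold pole. simpl (_ ^ (2 * 0)). now rewrite !Rmult_1_l.
Qed.

Lemma coth_partial_fractions_series (y : R) : 0 < y ->
  is_series (pole 0 (- (y / PI) ^ 2)) ((y * cosh y / sinh y - 1) / (2 * (y / PI) ^ 2)).
Proof.
  intros Hy. set (x := y / PI). pose proof PI_RGT_0 as Hpi.
  assert (Hx : 0 < x) by (unfold x; apply Rdiv_lt_0_compat; lra).
  assert (E2 : 2 * x * (PI / 2) = y) by (unfold x; field; lra).
  assert (Hs : 0 < sinh y).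
  { unfold sinh. pose proof (exp_increasing (- y) y). lra. }
  assert (H : is_series (fun k => / (INR (S k) ^ 2 - -1 * x ^ 2))
    ((1 - PI * x * cosh (2 * x * (PI / 2)) / sinh (2 * x * (PI / 2))) / (2 * (-1 * x ^ 2)))).
  (* For [0 <= u <= y], [cosh u >= exp u / 2 >= 1 / 2] and [cosh u <= exp u <= exp y]. *)
  { apply (is_series_partial_fractions (fun t => cosh (2 * x * t)) (fun t => sinh (2 * x * t))
             (-1) x (1 / 2) (exp y)); try lra.
    - intros t. unfold cosh, sinh. auto_derive; [trivial|field].
    - intros t. unfold cosh, sinh. auto_derive; [trivial|field].
    - rewrite Rmult_0_r. apply sinh_0.
    - simpl; nra.
    - intros t Ht. assert (2 * x * t <= 2 * x * (PI / 2)) by (apply Rmult_le_compat_l; lra).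
      assert (0 <= 2 * x * t) by (apply Rmult_le_pos; lra). unfold cosh.
      set (u := 2 * x * t) in *.
      pose proof (exp_pos (- u)). pose proof (exp_ineq1_le u).
      assert (exp u <= exp y) by (destruct (Req_dec u y) as [->|]; [lra|left; apply exp_increasing; lra]).
      assert (exp (- u) <= exp u)
        by (destruct (Req_dec u (- u)) as [<-|]; [lra|left; apply exp_increasing; lra]).
      lra.
    - rewrite E2. exact Hs. }
  rewrite E2 in H.
  replace ((y * cosh y / sinh y - 1) / (2 * x ^ 2)) with
    ((1 - PI * x * cosh y / sinh y) / (2 * (-1 * x ^ 2))).
  - revert H. apply is_series_ext. intros k. unfold pole. simpl (_ ^ (2 * 0)).
    rewrite Rmult_1_l. f_equal. ring.
  - replace (PI * x) with y by (unfold x; field; lra). simpl. field. lra.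
Qed.

(** * Convergence, monotonicity and recursion of the pole sums *)

Lemma INR_S_pow_ge_1 (k n : nat) : 1 <= INR (S k) ^ n.
Proof. apply pow_R1_Rle. rewrite S_INR. pose proof (pos_INR k). lra. Qed.

(** Convergence is inherited from the [coth] series at [y = PI], whose terms are [1 / (k^2 + 1)],
    since [1 / k^2 <= 2 / (k^2 + 1)]. *)
Lemma ex_series_inv_sqr : ex_series (fun k => / INR (S k) ^ 2).
Proof.
  pose proof PI_RGT_0 as Hpi.
  apply (ex_series_le (V := R_CompleteNormedModule) _ (fun k => 2 * pole 0 (- (PI / PI) ^ 2) k)).
  - intros k. change (Rabs (/ INR (S k) ^ 2) <= 2 * pole 0 (- (PI / PI) ^ 2) k).
    pose proof (INR_S_pow_ge_1 k 2) as Hq. unfold pole.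
    replace (PI / PI) with 1 by (field; lra). rewrite Nat.mul_0_r, pow_O, pow1.
    set (q := INR (S k) ^ 2) in *.
    rewrite Rabs_pos_eq by (apply Rlt_le, Rinv_0_lt_compat; lra).
    replace (2 * _) with (/ ((q + 1) / 2)) by (field; lra).
    apply Rinv_le_contravar; lra.
  - apply (ex_series_scal (V := R_NormedModule) 2). eexists. apply (coth_partial_fractions_series PI Hpi).
Qed.

Lemma pole_pos (N : nat) (s : R) (k : nat) : s < 1 -> 0 < pole N s k.
Proof.
  intros Hs. apply Rinv_0_lt_compat.
  pose proof (INR_S_pow_ge_1 k (2 * N)). pose proof (INR_S_pow_ge_1 k 2).
  apply Rmult_lt_0_compat; lra.
Qed.

Lemma ex_series_pole (N : nat) (s : R) : s < 1 -> ex_series (pole N s).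
Proof.
  (* With this [c], [c * k^2 <= k^2 - s] for all [k >= 1]: clear if [s <= 0], and otherwise
     [(1 - s) k^2 <= k^2 - s] because [k^2 >= 1]. *)
  intros Hs. set (c := Rmin 1 (1 - s)).
  assert (Hc : 0 < c) by (unfold c; apply Rmin_glb_lt; lra).
  pose proof (Rmin_l 1 (1 - s)). pose proof (Rmin_r 1 (1 - s)). fold c in H, H0.
  apply (ex_series_le (V := R_CompleteNormedModule) _ (fun k => / c * / INR (S k) ^ 2)).
  - intros k. change (Rabs (pole N s k) <= / c * / INR (S k) ^ 2).
    rewrite Rabs_pos_eq by (apply Rlt_le, pole_pos, Hs).
    pose proof (INR_S_pow_ge_1 k (2 * N)). pose proof (INR_S_pow_ge_1 k 2).
    rewrite <- Rinv_mult. apply Rinv_le_contravar; [apply Rmult_lt_0_compat; lra|].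
    apply (Rle_trans _ (1 * (INR (S k) ^ 2 - s))).
    + destruct (Rle_dec s 0); nra.
    + apply Rmult_le_compat_r; lra.
  - apply (ex_series_scal (V := R_NormedModule) (/ c)), ex_series_inv_sqr.
Qed.

Lemma pole_le (N : nat) (s s' : R) (k : nat) : s <= s' -> s' < 1 -> pole N s k <= pole N s' k.
Proof.
  intros Hs Hs'. pose proof (INR_S_pow_ge_1 k (2 * N)). pose proof (INR_S_pow_ge_1 k 2).
  apply Rinv_le_contravar; [apply Rmult_lt_0_compat; lra|].
  apply Rmult_le_compat_l; lra.
Qed.

Lemma poles_le (N : nat) (s s' : R) : s <= s' -> s' < 1 -> 0 <= poles N s <= poles N s'.
Proof.
  intros Hs Hs'.
  assert (Hle : forall k, 0 <= pole N s k <= pole N s' k).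
  { intros k. split; [apply Rlt_le, pole_pos; lra|now apply pole_le]. }
  split; [|apply Series_le; [exact Hle|now apply ex_series_pole]].
  rewrite <- (Rmult_0_l (poles N s)). unfold poles at 1. rewrite <- Series_scal_l.
  apply Series_le; [|apply ex_series_pole; lra].
  intros k. pose proof (Hle k). lra.
Qed.

(** Termwise [1 / (k^2 - s) = 1 / k^2 + s / (k^2 (k^2 - s))]. Iteration peels off the Taylor
    coefficients [poles J 0] one by one with an exact remainder. *)
Lemma poles_step (N : nat) (s : R) : s < 1 -> poles N s = poles N 0 + s * poles (S N) s.
Proof.
  intros Hs. unfold poles. rewrite <- Series_scal_l, <- Series_plus.
  - apply Series_ext. intros k. unfold pole.
    replace (2 * S N)%nat with (2 + 2 * N)%nat by lia. rewrite pow_add.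
    pose proof (INR_S_pow_ge_1 k (2 * N)). pose proof (INR_S_pow_ge_1 k 2).
    set (q := INR (S k) ^ 2) in *. field. lra.
  - apply ex_series_pole. lra.
  - apply (ex_series_scal (V := R_NormedModule) s). now apply ex_series_pole.
Qed.

Lemma Series_pos (a : nat -> R) : ex_series a -> (forall k, 0 < a k) -> 0 < Series a.
Proof.
  intros Ha Hpos. rewrite Series_incr_1 by exact Ha.
  assert (Ha' : ex_series (fun k => a (S k))) by now apply (ex_series_incr_1 a).
  assert (0 <= Series (fun k => a (S k))).
  { rewrite <- (Rmult_0_l (Series (fun k => a (S k)))), <- Series_scal_l.
    apply Series_le; [|exact Ha']. intros k. pose proof (Hpos (S k)). lra. }
  pose proof (Hpos 0%nat). lra.
Qed.

(** * The remainder function and its behaviour up to the endpoints *)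

(** The half angle [x / 2] turns [s] into [s / 4]. Its Taylor remainder carries [(s / 4) ^ N], and
    division by [s ^ N] leaves the weight [/ 4 ^ N]. *)
Definition remainder (N : nat) (s : R) : R := poles N s - / 4 ^ N * poles N (s / 4).

Lemma remainder_step (N : nat) (s : R) : s < 1 ->
  remainder N s = (1 - / 4 ^ N) * poles N 0 + s * remainder (S N) s.
Proof.
  intros Hs. unfold remainder.
  destruct (Rle_dec 0 s).
  - rewrite (poles_step N s), (poles_step N (s / 4)) by lra. simpl.
    field. apply pow_nonzero. lra.
  - rewrite (poles_step N s), (poles_step N (s / 4)) by lra. simpl.
    field. apply pow_nonzero. lra.
Qed.

Lemma remainder_0 (N : nat) : remainder N 0 = (1 - / 4 ^ N) * poles N 0.
Proof. rewrite remainder_step by lra. ring. Qed.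

Lemma pole_diff (N : nat) (a b : R) (k : nat) : a < 1 -> b < 1 ->
  pole N b k - pole N a k = (b - a) * (pole N a k * / (INR (S k) ^ 2 - b)).
Proof.
  intros Ha Hb. unfold pole.
  pose proof (INR_S_pow_ge_1 k (2 * N)). pose proof (INR_S_pow_ge_1 k 2).
  field. lra.
Qed.

(** Termwise, the increment is [(b - a) (X - 4^(-N) Y / 4)], where [0 < Y <= X] because the poles
    grow with [s]. *)
Lemma remainder_increasing (N : nat) (a b : R) :
  0 <= a -> a < b -> b < 1 -> remainder N a < remainder N b.
Proof.
  intros Ha Hab Hb. apply Rlt_0_minus. unfold remainder, poles.
  rewrite <- !Series_scal_l.
  pose proof (ex_series_pole N a ltac:(lra)) as Ea.
  pose proof (ex_series_pole N b ltac:(lra)) as Eb.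
  pose proof (ex_series_scal (V := R_NormedModule) (/ 4 ^ N) _ (ex_series_pole N (a / 4) ltac:(lra))) as Ea4.
  pose proof (ex_series_scal (V := R_NormedModule) (/ 4 ^ N) _ (ex_series_pole N (b / 4) ltac:(lra))) as Eb4.
  pose proof (ex_series_minus (V := R_NormedModule) _ _ Ea Ea4) as Ga.
  pose proof (ex_series_minus (V := R_NormedModule) _ _ Eb Eb4) as Gb.
  rewrite <- !Series_minus by assumption.
  apply Series_pos; [exact (ex_series_minus (V := R_NormedModule) _ _ Gb Ga)|].
  intros k.
  replace (_ - _) with ((pole N b k - pole N a k)
    - / 4 ^ N * (pole N (b / 4) k - pole N (a / 4) k)) by ring.
  rewrite !pole_diff by lra.
  pose proof (INR_S_pow_ge_1 k 2) as Hq. set (q := INR (S k) ^ 2) in *.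
  pose proof (pole_le N (a / 4) a k ltac:(lra) ltac:(lra)) as H1.
  pose proof (pole_pos N (a / 4) k ltac:(lra)) as H2.
  pose proof (pole_pos N a k ltac:(lra)) as H3.
  assert (H4 : 0 < / (q - b)) by (apply Rinv_0_lt_compat; lra).
  assert (H5 : 0 < / (q - b / 4)) by (apply Rinv_0_lt_compat; lra).
  assert (H6 : / (q - b / 4) <= / (q - b)) by (apply Rinv_le_contravar; lra).
  set (X := pole N a k * / (q - b)). set (Y := pole N (a / 4) k * / (q - b / 4)).
  assert (HX : 0 < X) by now apply Rmult_lt_0_compat.
  assert (HY : 0 < Y) by now apply Rmult_lt_0_compat.
  assert (HXY : Y <= X) by (apply Rmult_le_compat; [lra | lra | exact H1 | exact H6]).
  assert (H7 : / 4 ^ N <= 1).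
  { rewrite <- Rinv_1. apply Rinv_le_contravar; [lra|]. apply pow_R1_Rle. lra. }
  replace (_ - _) with ((b - a) * (X - / 4 ^ N * Y / 4))
    by (unfold X, Y; field; repeat split; try (apply pow_nonzero); lra).
  apply Rmult_lt_0_compat; [lra|].
  assert (/ 4 ^ N * Y <= 1 * Y) by (apply Rmult_le_compat_r; lra). lra.
Qed.

Lemma remainder_lipschitz (N : nat) (a b : R) : 0 <= a <= b -> b <= 1 / 4 ->
  remainder N b - remainder N a <= (b - a) * (4 / 3 * poles N (1 / 4)).
Proof.
  intros Hab Hb. unfold remainder.
  assert (H : poles N b - poles N a <= (b - a) * (4 / 3 * poles N (1 / 4))).
  { unfold poles. rewrite <- Rmult_assoc, <- Series_scal_l.
    rewrite <- Series_minus by (apply ex_series_pole; lra).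
    apply Series_le.
    - intros k. rewrite pole_diff by lra.
      pose proof (INR_S_pow_ge_1 k 2) as Hq. set (q := INR (S k) ^ 2) in *.
      pose proof (pole_le N a (1 / 4) k ltac:(lra) ltac:(lra)) as H1.
      pose proof (pole_pos N a k ltac:(lra)) as H3.
      assert (H4 : 0 < / (q - b)) by (apply Rinv_0_lt_compat; lra).
      assert (H5 : / (q - b) <= 4 / 3).
      { replace (4 / 3) with (/ (3 / 4)) by field. apply Rinv_le_contravar; lra. }
      assert (0 < pole N a k * / (q - b)) by now apply Rmult_lt_0_compat.
      split; [apply Rmult_le_pos; lra|].
      rewrite Rmult_assoc, (Rmult_comm (4 / 3)). apply Rmult_le_compat_l; [lra|].
      apply Rmult_le_compat; lra.
    - apply (ex_series_scal (V := R_NormedModule)), ex_series_pole. lra. }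
  pose proof (poles_le N (a / 4) (b / 4) ltac:(lra) ltac:(lra)) as H1.
  assert (0 < / 4 ^ N) by (apply Rinv_0_lt_compat, pow_lt; lra).
  assert (/ 4 ^ N * poles N (a / 4) <= / 4 ^ N * poles N (b / 4))
    by (apply Rmult_le_compat_l; lra).
  lra.
Qed.

(** * Taylor coefficients from a one-sided estimate *)

Lemma continuous_small_eq_0 (h : R -> R) (r K : R) (M : nat) :
  continuity_pt h 0 -> 0 < r ->
  (forall t, 0 < t < r -> Rabs (h t) <= K * t ^ S M) -> h 0 = 0.
Proof.
  intros Hc Hr Hb. destruct (Req_dec (h 0) 0) as [E|Hne]; [exact E|exfalso].
  pose proof (Rabs_pos_lt _ Hne) as Hpos.
  destruct (Hc (Rabs (h 0) / 2)) as [d [Hd Hcd]]; [lra|].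
  pose proof (Rabs_pos K) as HK.
  (* For [t < e] and [t < 1] the hypothesis forces [Rabs (h t) < Rabs (h 0) / 2], while continuity
     keeps [h t] within [Rabs (h 0) / 2] of [h 0]. *)
  set (e := Rabs (h 0) / 2 / (Rabs K + 1)).
  assert (He : 0 < e) by (apply Rdiv_lt_0_compat; lra).
  set (t := Rmin (Rmin d r) (Rmin 1 e) / 2).
  assert (Ht : 0 < t /\ t < d /\ t < r /\ t < 1 /\ t < e).
  { unfold t.
    pose proof (Rmin_glb_lt _ _ 0 (Rmin_glb_lt d r 0 Hd Hr) (Rmin_glb_lt 1 e 0 Rlt_0_1 He)).
    pose proof (Rmin_l (Rmin d r) (Rmin 1 e)). pose proof (Rmin_r (Rmin d r) (Rmin 1 e)).
    pose proof (Rmin_l d r). pose proof (Rmin_r d r).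
    pose proof (Rmin_l 1 e). pose proof (Rmin_r 1 e). repeat split; lra. }
  destruct Ht as (Ht0 & Htd & Htr & Ht1 & Hte).
  assert (H1 : Rabs (h t - h 0) < Rabs (h 0) / 2).
  { apply (Hcd t). split.
    - split; [exact I|lra].
    - simpl. unfold Rdist. rewrite Rminus_0_r, Rabs_pos_eq; lra. }
  assert (H2 : Rabs (h t) < Rabs (h 0) / 2).
  { apply (Rle_lt_trans _ _ _ (Hb t (conj Ht0 Htr))).
    apply (Rle_lt_trans _ (Rabs K * t)).
    - simpl. assert (0 <= t ^ M <= 1).
      { split; [apply pow_le; lra|]. rewrite <- (pow1 M). apply pow_incr. lra. }
      apply (Rle_trans _ (Rabs K * (t * t ^ M))).
      + apply Rmult_le_compat_r; [nra|]. apply Rle_abs.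
      + apply Rmult_le_compat_l; [lra|]. nra.
    - apply (Rle_lt_trans _ ((Rabs K + 1) * t)); [nra|].
      apply (Rlt_le_trans _ ((Rabs K + 1) * e)); [apply Rmult_lt_compat_l; lra|].
      unfold e. right. field. lra. }
  pose proof (Rabs_triang (h t) (- (h t - h 0))) as H3.
  rewrite Rabs_Ropp in H3. replace (h t + - (h t - h 0)) with (h 0) in H3 by ring. lra.
Qed.

Lemma continuity_pt_sum_f_R0 (c : nat -> R) (M : nat) (t : R) :
  continuity_pt (fun u => sum_f_R0 (fun n => c n * u ^ n) M) t.
Proof.
  assert (H : forall k, continuity_pt (fun u => c k * u ^ k) t).
  { intros k. apply continuity_pt_scal, derivable_continuous_pt, derivable_pt_pow. }
  induction M as [|M IH]; [apply H|]. now apply continuity_pt_plus.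
Qed.

(** Letting [t] tend to [0] identifies the constant terms; they cancel, division by [t] shifts both
    coefficient sequences, and induction on [M] reaches the top coefficient. *)
Lemma PSeries_coeff_of_Taylor (M : nat) : forall (b c : nat -> R) (r K : R),
  Rbar_lt 0 (CV_radius b) -> 0 < r ->
  (forall t, 0 < t < r -> ex_pseries b t) ->
  (forall t, 0 < t < r ->
     Rabs (PSeries b t - sum_f_R0 (fun n => c n * t ^ n) M) <= K * t ^ S M) ->
  b M = c M.
Proof.
  assert (H0 : forall M (b c : nat -> R) (r K : R),
    Rbar_lt 0 (CV_radius b) -> 0 < r ->
    (forall t, 0 < t < r ->
       Rabs (PSeries b t - sum_f_R0 (fun n => c n * t ^ n) M) <= K * t ^ S M) ->
    b 0%nat = c 0%nat).
  { clear M. intros M b c r K Hcv Hr Hb.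
    pose proof (continuous_small_eq_0
      (fun t => PSeries b t - sum_f_R0 (fun n => c n * t ^ n) M) r K M) as H.
    cbv beta in H. rewrite PSeries_0 in H.
    assert (E : sum_f_R0 (fun n => c n * 0 ^ n) M = c 0%nat).
    { clear. induction M as [|M IH]; simpl; [ring|]. rewrite IH. ring. }
    rewrite E in H. enough (b 0%nat - c 0%nat = 0) by lra. apply H; [|exact Hr|exact Hb].
    apply (continuity_pt_minus (PSeries b)).
    - apply PSeries_continuity. now rewrite Rabs_R0.
    - apply continuity_pt_sum_f_R0. }
  induction M as [|M IH]; intros b c r K Hcv Hr Hex Hb; [now apply (H0 0%nat b c r K)|].
  apply (IH (PS_decr_1 b) (fun n => c (S n)) r K).
  - now rewrite CV_radius_decr_1.
  - exact Hr.
  - intros t Ht. apply ex_pseries_decr_1; [|now apply Hex].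
    right. exists (/ t). apply Rinv_l. lra.
  - pose proof (H0 _ _ _ _ _ Hcv Hr Hb) as E. intros t Ht. specialize (Hb t Ht).
    rewrite (PSeries_decr_1 _ _ (Hex t Ht)) in Hb.
    rewrite E, decomp_sum in Hb by lia. simpl pred in Hb.
    apply (Rmult_le_reg_l t); [lra|].
    rewrite <- (Rabs_pos_eq t) at 1 by lra. rewrite <- Rabs_mult.
    replace (t * (K * t ^ S M)) with (K * t ^ S (S M)) by (simpl; ring).
    revert Hb. apply Rle_trans. right. f_equal.
    rewrite Rmult_minus_distr_l, scal_sum.
    rewrite (sum_eq _ (fun i => c (S i) * t ^ S i)) by (intros; simpl; ring).
    simpl. ring.
Qed.

(** * Bernoulli numbers as values of the pole sums *)

Lemma coth_partial_fractions (t : R) : 0 < t ->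
  t / (exp t - 1)
  = 1 - t / 2 - 2 * (- (t / 2 / PI) ^ 2) * poles 0 (- (t / 2 / PI) ^ 2).
Proof.
  intros Ht. pose proof PI_RGT_0 as Hpi.
  assert (Ey : exists y, t = 2 * y) by (exists (t / 2); field). destruct Ey as [y Ey].
  assert (Hy : 0 < y) by lra. replace (t / 2) with y by lra.
  unfold poles. rewrite (is_series_unique _ _ (coth_partial_fractions_series y Hy)).
  replace (exp t) with (exp y * exp y) by (rewrite <- exp_plus; f_equal; lra).
  assert (1 < exp y) by (rewrite <- exp_0; apply exp_increasing; lra).
  unfold cosh, sinh. rewrite exp_Ropp, Ey.
  set (w := exp y) in *. field. repeat split; nra.
Qed.

(** The expected values of [B n / n!]. The even case is Euler's formula [B_(2k) / (2k)! = (-1)^(k+1)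
    2 zeta(2k) / (2 pi)^(2k)] with [k = J + 1]. *)
Definition bernoulli_taylor (n : nat) : R :=
  match n with
  | O => 1
  | S O => - / 2
  | S (S m) => if Nat.even m
      then - 2 * poles (Nat.div2 m) 0 * (- / (2 * PI) ^ 2) ^ S (Nat.div2 m) else 0
  end.

Lemma bernoulli_taylor_even (J : nat) :
  bernoulli_taylor (2 * J + 2) = - 2 * poles J 0 * (- / (2 * PI) ^ 2) ^ S J.
Proof.
  rewrite Nat.add_comm. cbn [Nat.add bernoulli_taylor].
  now rewrite Nat.even_even, Nat.div2_double.
Qed.

Lemma bernoulli_taylor_odd (J : nat) : bernoulli_taylor (2 * J + 3) = 0.
Proof.
  replace (2 * J + 3)%nat with (S (S (2 * J + 1))) by lia. cbn [bernoulli_taylor].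
  now rewrite Nat.even_odd.
Qed.

(** Each [poles_step] at [s = - (t / (2 PI))^2] extracts one more even coefficient. Since
    [s <= 0 < 1], this finite identity holds for every [t > 0], also beyond [2 PI]. *)
Lemma bernoulli_taylor_remainder (J : nat) (t : R) : 0 < t ->
  t / (exp t - 1) - sum_f_R0 (fun n => bernoulli_taylor n * t ^ n) (2 * J + 2)
  = - 2 * (- (t / 2 / PI) ^ 2) ^ (J + 2) * poles (S J) (- (t / 2 / PI) ^ 2).
Proof.
  intros Ht. pose proof PI_RGT_0.
  set (s := - (t / 2 / PI) ^ 2).
  assert (Hs : s < 1) by (unfold s; pose proof (pow2_ge_0 (t / 2 / PI)); lra).
  assert (Hpow : forall j, (- / (2 * PI) ^ 2) ^ j * t ^ (2 * j) = s ^ j).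
  { intros j. rewrite pow_mult, <- Rpow_mult_distr. f_equal. unfold s. field. lra. }
  induction J as [|J IH].
  - rewrite coth_partial_fractions by exact Ht. fold s.
    rewrite (poles_step 0 s) by exact Hs.
    rewrite (poles_step 1 s) by exact Hs.
    pose proof (bernoulli_taylor_even 0) as E.
    change (2 * 0 + 2)%nat with 2%nat in *. cbn [sum_f_R0]. rewrite E.
    pose proof (Hpow 1%nat) as P1. change (2 * 1)%nat with 2%nat in P1.
    rewrite (Rmult_assoc _ _ (t ^ 2)), P1. cbn [bernoulli_taylor]. simpl. field.
  - replace (2 * S J + 2)%nat with (S (S (2 * J + 2))) by lia. cbn [sum_f_R0].
    replace (S (S (2 * J + 2))) with (2 * S J + 2)%nat by lia.
    replace (S (2 * J + 2)) with (2 * J + 3)%nat by lia.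
    rewrite bernoulli_taylor_odd, bernoulli_taylor_even.
    rewrite (Rmult_assoc (-2 * _)).
    replace (2 * S J + 2)%nat with (2 * S (S J))%nat by lia. rewrite Hpow.
    match goal with |- ?a - (?u + ?v + ?w) = _ =>
      replace (a - (u + v + w)) with ((a - u) - w) by ring end.
    rewrite IH, (poles_step (S J) s) by exact Hs.
    replace (S J + 2)%nat with (S (J + 2)) by lia.
    replace (S (S J)) with (J + 2)%nat by lia. simpl. ring.
Qed.

(** The power series supplied by [is_bernoulli] is compared with the finite expansion, whose
    remainder is [O(t^(2J+4))] because [poles (S J) s <= poles (S J) 0] for [s <= 0]. *)
Lemma bernoulli_even (B : nat -> R) (J : nat) : is_bernoulli B ->
  B (2 * J + 2)%nat / INR (fact (2 * J + 2)) = - 2 * poles J 0 * (- / (2 * PI) ^ 2) ^ S J.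
Proof.
  intros HB. pose proof PI_RGT_0 as Hpi.
  rewrite <- bernoulli_taylor_even. set (b := fun n => B n / INR (fact n)).
  assert (Hser : forall t, 0 < t < 2 * PI -> is_pseries b t (t / (exp t - 1))).
  { intros t Ht. apply is_pseries_R, (is_series_ext (fun n => B n * t ^ n / INR (fact n))).
    - intros n. change (B n * t ^ n / INR (fact n) = B n / INR (fact n) * t ^ n). field. apply INR_fact_neq_0.
    - apply is_series_Reals, HB. rewrite Rabs_pos_eq; lra. }
  change (b (2 * J + 2)%nat = bernoulli_taylor (2 * J + 2)).
  (* One of the [2 J + 4] factors [t] in the remainder is bounded by [2 PI], which leaves the power
     [2 J + 3] that the comparison asks for. *)
  apply (PSeries_coeff_of_Taylor _ b bernoulli_taylor (2 * PI)
    (2 * poles (S J) 0 * (2 * PI) / (2 * PI) ^ (2 * J + 4))).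
  (* The series converges at [PI < 2 PI], so its terms tend to [0] there and the radius is at least
     [PI]. *)
  - apply (Rbar_lt_le_trans 0 PI); [exact Hpi|]. apply Rbar_not_lt_le. intros Hlt.
    apply (CV_disk_outside b PI); [now rewrite Rabs_pos_eq by lra|].
    apply ex_series_lim_0. eexists. apply is_pseries_R, Hser. lra.
  - lra.
  - intros t Ht. eexists. apply Hser, Ht.
  - intros t Ht. rewrite (is_pseries_unique _ _ _ (Hser t Ht)).
    rewrite bernoulli_taylor_remainder by lra.
    set (s := - (t / 2 / PI) ^ 2).
    pose proof (poles_le (S J) s 0 ltac:(unfold s; pose proof (pow2_ge_0 (t / 2 / PI)); lra) ltac:(lra)) as Hp.
    rewrite !Rabs_mult. rewrite <- RPow_abs, (Rabs_pos_eq (poles _ _)) by lra.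
    assert (Es : Rabs s = (t / (2 * PI)) ^ 2).
    { unfold s. rewrite Rabs_Ropp, Rabs_pos_eq by apply pow2_ge_0. field. lra. }
    rewrite Es, Rabs_left, <- pow_mult by lra.
    replace (2 * (J + 2))%nat with (2 * J + 4)%nat by lia.
    unfold Rdiv at 1. rewrite Rpow_mult_distr, pow_inv.
    assert (Hq : 0 < / (2 * PI) ^ (2 * J + 4)) by (apply Rinv_0_lt_compat, pow_lt; lra).
    replace (2 * J + 4)%nat with (S (S (2 * J + 2))) at 1 by lia.
    assert (Ht2 : 0 < t ^ S (2 * J + 2)) by (apply pow_lt; lra).
    replace (t ^ S (S (2 * J + 2))) with (t * t ^ S (2 * J + 2)) by reflexivity.
    set (q := / (2 * PI) ^ (2 * J + 4)) in *. unfold Rdiv. fold q.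
    set (v := t ^ S (2 * J + 2)) in *. clearbody q v.
    apply (Rle_trans _ (2 * (t * v * q) * poles (S J) 0)).
    + replace (- -2) with 2 by ring. apply Rmult_le_compat_l; [|lra].
      repeat apply Rmult_le_pos; lra.
    + replace (2 * (t * v * q) * poles (S J) 0) with (2 * poles (S J) 0 * q * v * t) by ring.
      replace (2 * poles (S J) 0 * (2 * PI) * q * v) with (2 * poles (S J) 0 * q * v * (2 * PI)) by ring.
      apply Rmult_le_compat_l; [|lra]. repeat apply Rmult_le_pos; lra.
Qed.

(** [2^(2J+2) - 4 = 4^(J+1) (1 - 4^(-J))], and [4^(J+1)] cancels the power of [2] in
    [(2 pi)^(2J+2)]. Up to powers of [PI], the result is twice the term split off by
    [remainder_step]. *)
Lemma coef_eq (B : nat -> R) (J : nat) : is_bernoulli B ->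
  coef B (S J) = 2 * (1 - / 4 ^ J) * poles J 0 / PI ^ (2 * J + 2).
Proof.
  intros HB. pose proof PI_RGT_0 as Hpi. pose proof (bernoulli_even B J HB) as E.
  unfold coef. replace (2 * S J)%nat with (2 * J + 2)%nat by lia.
  assert (Hf : 0 < INR (fact (2 * J + 2))) by apply INR_fact_lt_0.
  assert (E' : Rabs (B (2 * J + 2)%nat) / INR (fact (2 * J + 2))
               = 2 * poles J 0 * / (4 ^ S J * PI ^ (2 * J + 2))).
  { rewrite <- (Rabs_pos_eq (INR _)) at 1 by lra.
    rewrite <- Rabs_div by lra. rewrite E, !Rabs_mult, <- RPow_abs, Rabs_Ropp.
    pose proof (poles_le J 0 0 ltac:(lra) ltac:(lra)).
    assert (0 < / (2 * PI) ^ 2) by (apply Rinv_0_lt_compat, pow_lt; lra).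
    rewrite (Rabs_left (-2)), (Rabs_pos_eq (poles J 0)), (Rabs_pos_eq (/ _)) by lra.
    rewrite pow_inv, <- pow_mult, Rpow_mult_distr.
    replace (2 * J + 2)%nat with (2 * S J)%nat by lia.
    rewrite (pow_mult 2 2). replace (2 ^ 2) with 4 by ring. ring. }
  unfold Rdiv at 1. rewrite Rmult_assoc. fold (Rdiv (Rabs (B (2 * J + 2)%nat)) (INR (fact (2 * J + 2)))).
  rewrite E'.
  replace (2 ^ (2 * J + 2)) with (4 * 4 ^ J)
    by (rewrite pow_add, pow_mult; replace (2 ^ 2) with 4 by ring; ring).
  simpl (4 ^ S J). field. split; apply pow_nonzero; lra.
Qed.

(** * [Fdiff] as a multiple of the remainder *)

Lemma div_sin_eq (y : R) : sin (y / 2) <> 0 -> cos (y / 2) <> 0 -> cos y <> 0 ->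
  y / sin y = 2 * (y / 2 / tan (y / 2)) - y / tan y.
Proof.
  intros Hs Hc Hcy. unfold tan.
  assert (Hc' : cos y = 2 * cos (y / 2) * cos (y / 2) - 1)
    by (rewrite <- cos_2a_cos; f_equal; field).
  assert (Hsy : sin y = 2 * sin (y / 2) * cos (y / 2)) by (rewrite <- sin_2a; f_equal; field).
  transitivity ((y * (2 * cos (y / 2) * cos (y / 2)) - y * cos y) / sin y).
  - rewrite Hc', Hsy. field. split; assumption.
  - rewrite Hsy. field. repeat split; assumption.
Qed.

(** For [N = 0] this is the difference of the cotangent expansions at [x / 2] and [x]; each
    [remainder_step] then accounts for exactly one further summand of [Fdiff]. *)
Lemma Fdiff_eq (B : nat -> R) (N : nat) (x : R) : is_bernoulli B -> 0 < x < PI / 2 ->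
  Fdiff B N x = 2 * ((x / PI) ^ 2) ^ S N * remainder N ((x / PI) ^ 2).
Proof.
  intros HB Hx. pose proof PI_RGT_0 as Hpi. unfold Fdiff.
  rewrite div_sin_eq; [|apply Rgt_not_eq, sin_gt_0; lra
    |apply Rgt_not_eq, cos_gt_0; lra|apply Rgt_not_eq, cos_gt_0; lra].
  rewrite (cot_partial_fractions x), (cot_partial_fractions (x / 2)) by lra.
  replace ((x / 2 / PI) ^ 2) with ((x / PI) ^ 2 / 4) by (field; lra).
  assert (Hs : (x / PI) ^ 2 < 1).
  { assert (0 < x / PI < 1).
    { split; [apply Rdiv_lt_0_compat; lra|]. apply Rlt_div_l; lra. } nra. }
  assert (Hpow : forall j, x ^ (2 * j) = PI ^ (2 * j) * ((x / PI) ^ 2) ^ j).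
  { intros j. rewrite <- pow_mult, <- Rpow_mult_distr. f_equal. field. lra. }
  set (s := (x / PI) ^ 2) in *.
  induction N as [|N IH].
  - unfold remainder. simpl. field.
  - rewrite (remainder_step N s) in IH by exact Hs.
    cbn [sum_from2].
    assert (Hterm : (if Nat.leb 2 (S N) then coef B (S N) * x ^ (2 * S N) else 0)
                    = 2 * (1 - / 4 ^ N) * poles N 0 * s ^ S N).
    (* The sum has no [j = 1] term, in agreement with [1 - / 4 ^ 0 = 0]. *)
    { destruct N as [|N]; [simpl; field|]. cbn [Nat.leb].
      rewrite coef_eq, Hpow by exact HB.
      replace (2 * S (S N))%nat with (2 * S N + 2)%nat by lia. field.
      split; apply pow_nonzero; lra. }
    rewrite Hterm. cbn [pow] in *. lra.
Qed.

Lemma Fdiff_opp (B : nat -> R) (N : nat) (x : R) : sin x <> 0 -> tan x <> 0 ->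
  Fdiff B N (- x) = Fdiff B N x.
Proof.
  intros Hs Ht. unfold Fdiff. rewrite sin_neg, tan_neg.
  replace (- x / - sin x) with (x / sin x) by (field; exact Hs).
  replace (- x / - tan x) with (x / tan x) by (field; exact Ht).
  do 2 f_equal. induction N as [|N IH]; [reflexivity|]. cbn [sum_from2]. rewrite IH.
  now rewrite !(pow_mult (- x)), !(pow_mult x), <- Rsqr_pow2, <- Rsqr_neg, Rsqr_pow2.
Qed.

(** * The four series of the upper constant *)

(** The negative terms sit at odd zero-based indices, so removing them twice from the full sum gives
    the alternating one. Partial sums are taken up to [2 n + 1] to end on a complete pair. *)
Lemma alternating_series_split (a : nat -> R) (la lb lc : R) :
  is_series a la -> is_series (fun n => (-1) ^ n * a n) lb ->
  is_series (fun k => a (2 * k + 1)%nat) lc -> lb = la - 2 * lc.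
Proof.
  intros Ha Hb Hc.
  assert (Hsub : filterlim (fun n => (2 * n + 1)%nat) eventually eventually)
    by (apply eventually_subseq; intros n; lia).
  pose proof (is_lim_seq_subseq _ (Finite la) _ Hsub Ha) as La.
  pose proof (is_lim_seq_subseq _ (Finite lb) _ Hsub Hb) as Lb.
  assert (E : forall n, sum_n (fun n => (-1) ^ n * a n) (2 * n + 1)
    = sum_n a (2 * n + 1) - 2 * sum_n (fun k => a (2 * k + 1)%nat) n :> R).
  { intros n. rewrite !sum_n_Reals. induction n as [|n IH]; [simpl; ring|].
    replace (2 * S n + 1)%nat with (S (S (2 * n + 1))) by lia. cbn [sum_f_R0].
    rewrite IH. replace (S (S (2 * n + 1))) with (2 * S n + 1)%nat by lia.
    rewrite (pow_add _ (2 * S n)), pow_1_even.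
    replace (S (2 * n + 1)) with (2 * S n)%nat by lia. rewrite pow_1_even. ring. }
  apply (is_lim_seq_ext _ _ _ E) in Lb.
  pose proof (is_lim_seq_minus' _ _ _ _ La (is_lim_seq_scal_l _ 2 (Finite lc) Hc)) as L.
  apply is_lim_seq_unique in Lb. apply is_lim_seq_unique in L.
  pose proof (eq_trans (eq_sym Lb) L) as E'. now injection E'.
Qed.

(** [1 / (2k - 1) - 1 / (2k + 1) = (1 / 2) / (k^2 - 1 / 4)]; the numerator [c] covers both the
    alternating and the plain series. *)
Lemma telescoped_terms (N n : nat) (c : R) :
  c / (INR (S n) ^ (2 * N) * (2 * INR (S n) - 1)) - c / (INR (S n) ^ (2 * N) * (2 * INR (S n) + 1))
  = c * (/ 2 * pole N (1 / 4) n).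
Proof.
  unfold pole. pose proof (INR_S_pow_ge_1 n (2 * N)). pose proof (INR_S_pow_ge_1 n 1) as H1.
  rewrite pow_1 in H1. field. repeat split; nra.
Qed.

(** Index [2 k + 1] stands for the integer [2 m] with [m = k + 1], and
    [(2m)^2 - 1/4 = 4 (m^2 - 1/16)]. *)
Lemma pole_odd_index (N k : nat) :
  pole N (1 / 4) (2 * k + 1) = / 4 ^ S N * pole N (1 / 4 / 4) k.
Proof.
  unfold pole. pose proof (INR_S_pow_ge_1 k (2 * N)). pose proof (INR_S_pow_ge_1 k 1) as H1.
  rewrite pow_1 in H1.
  replace (INR (S (2 * k + 1))) with (2 * INR (S k))
    by (rewrite !S_INR, plus_INR, mult_INR; simpl; ring).
  rewrite Rpow_mult_distr, (pow_mult 2 2). replace (2 ^ 2) with 4 by ring.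
  assert (0 < 4 ^ N) by (apply pow_lt; lra). simpl (4 ^ S N). field. repeat split; nra.
Qed.

(** With [P = poles N (1/4)] and [Q = poles N (1/16)], the differences are
    [S1 - S2 = P / 2 - Q / 4^(N+1)] and [S3 - S4 = P / 2]. *)
Lemma upper_constant (N : nat) (S1 S2 S3 S4 : R)
  (H1 : infinite_sum (fun n => (-1) ^ n / (INR (S n) ^ (2 * N) * (2 * INR (S n) - 1))) S1)
  (H2 : infinite_sum (fun n => (-1) ^ n / (INR (S n) ^ (2 * N) * (2 * INR (S n) + 1))) S2)
  (H3 : infinite_sum (fun n => 1 / (INR (S n) ^ (2 * N) * (2 * INR (S n) - 1))) S3)
  (H4 : infinite_sum (fun n => 1 / (INR (S n) ^ (2 * N) * (2 * INR (S n) + 1))) S4) :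
  8 * (S1 - S2) - 4 * (S3 - S4) = 2 * remainder N (1 / 4).
Proof.
  apply is_series_Reals in H1, H2, H3, H4.
  pose proof (is_series_minus (V := R_NormedModule) _ _ _ _ H1 H2) as H12.
  pose proof (is_series_minus (V := R_NormedModule) _ _ _ _ H3 H4) as H34.
  apply (is_series_ext _ (fun n => (-1) ^ n * (/ 2 * pole N (1 / 4) n))) in H12;
    [|intros n; apply telescoped_terms].
  apply (is_series_ext _ (fun n => 1 * (/ 2 * pole N (1 / 4) n))) in H34;
    [|intros n; apply telescoped_terms].
  assert (Ea : is_series (fun n => / 2 * pole N (1 / 4) n) (/ 2 * poles N (1 / 4))).
  { apply (is_series_scal (V := R_NormedModule)), Series_correct, ex_series_pole. lra. }
  assert (Ec : is_series (fun k => / 2 * pole N (1 / 4) (2 * k + 1))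
                 (/ 2 * (/ 4 ^ S N * poles N (1 / 4 / 4)))).
  { apply (is_series_scal (V := R_NormedModule)).
    apply (is_series_ext (fun k => / 4 ^ S N * pole N (1 / 4 / 4) k)).
    - intros k. symmetry. apply pole_odd_index.
    - apply (is_series_scal (V := R_NormedModule)), Series_correct, ex_series_pole. lra. }
  pose proof (alternating_series_split _ _ _ _ Ea H12 Ec) as E12.
  apply (is_series_ext _ (fun n => / 2 * pole N (1 / 4) n)) in H34;
    [|intros n; apply Rmult_1_l].
  apply is_series_unique in Ea. apply is_series_unique in H34. rewrite Ea in H34.
  change (S1 - S2 = / 2 * poles N (1 / 4) - 2 * (/ 2 * (/ 4 ^ S N * poles N (1 / 4 / 4)))) in E12.
  change (/ 2 * poles N (1 / 4) = S3 - S4) in H34.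
  rewrite E12, <- H34. unfold remainder. simpl (4 ^ S N). field. apply pow_nonzero. lra.
Qed.

(** * The inequality and the best constants *)

Lemma le_of_lt_add_linear (u v K : R) :
  (forall s, 0 < s < 1 / 4 -> u <= v + s * K) -> u <= v.
Proof.
  intros H. destruct (Rle_lt_dec u v) as [|Hlt]; [assumption|exfalso].
  pose proof (Rabs_pos K). pose proof (Rle_abs K).
  (* Small enough that [s * Rabs K] stays below half of the assumed gap [u - v]; the bound [1 / 8]
     keeps [s] in the admissible range. *)
  set (s := Rmin (1 / 8) ((u - v) / 2 / (Rabs K + 1))).
  assert (Hs : 0 < s).
  { apply Rmin_glb_lt; [lra|]. apply Rdiv_lt_0_compat; lra. }
  assert (Hs1 : s <= 1 / 8) by apply Rmin_l.
  assert (Hs2 : s <= (u - v) / 2 / (Rabs K + 1)) by apply Rmin_r.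
  assert (s * (Rabs K + 1) <= (u - v) / 2) by (apply Rle_div_r; lra).
  specialize (H s ltac:(lra)). nra.
Qed.

Theorem theorem9 (B : nat -> R) (HB : is_bernoulli B) (N : nat) (HN : (1 <= N)%nat)
  (S1 S2 S3 S4 : R)
  (H1 : infinite_sum (fun n => (-1) ^ n / (INR (S n) ^ (2 * N) * (2 * INR (S n) - 1))) S1)
  (H2 : infinite_sum (fun n => (-1) ^ n / (INR (S n) ^ (2 * N) * (2 * INR (S n) + 1))) S2)
  (H3 : infinite_sum (fun n => 1 / (INR (S n) ^ (2 * N) * (2 * INR (S n) - 1))) S3)
  (H4 : infinite_sum (fun n => 1 / (INR (S n) ^ (2 * N) * (2 * INR (S n) + 1))) S4) :
  let aN := coef B (S N) in
  let bN := 8 / PI ^ (2 * N + 2)%nat * (S1 - S2) - 4 / PI ^ (2 * N + 2)%nat * (S3 - S4) in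
  (forall x : R, 0 < Rabs x < PI / 2 ->
     aN * x ^ (2 * N + 2)%nat < Fdiff B N x < bN * x ^ (2 * N + 2)%nat) /\
  (forall a : R, (forall x : R, 0 < Rabs x < PI / 2 -> a * x ^ (2 * N + 2)%nat < Fdiff B N x) ->
     a <= aN) /\
  (forall b : R, (forall x : R, 0 < Rabs x < PI / 2 -> Fdiff B N x < b * x ^ (2 * N + 2)%nat) ->
     bN <= b).
Proof.
  intros aN bN. pose proof PI_RGT_0 as Hpi.
  set (P := PI ^ (2 * N + 2)).
  assert (HP : 0 < P) by (apply pow_lt; lra).
  assert (Ea : aN * P = 2 * remainder N 0).
  { unfold aN. rewrite coef_eq, remainder_0 by exact HB. fold P. field.
    split; [apply pow_nonzero|]; lra. }
  assert (Eb : bN * P = 2 * remainder N (1 / 4)).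
  { rewrite <- (upper_constant N S1 S2 S3 S4 H1 H2 H3 H4). unfold bN. fold P. field. lra. }
  assert (Hpow : forall x, x ^ (2 * N + 2) = P * ((x / PI) ^ 2) ^ S N).
  { intros x. unfold P. replace (2 * N + 2)%nat with (2 * S N)%nat by lia.
    rewrite <- pow_mult, <- Rpow_mult_distr. f_equal. field. lra. }
  assert (Hs : forall x, 0 < x < PI / 2 -> 0 < (x / PI) ^ 2 < 1 / 4).
  { intros x Hx. assert (0 < x / PI < 1 / 2).
    { split; [apply Rdiv_lt_0_compat; lra|]. apply Rlt_div_l; lra. }
    simpl. nra. }
  (* Cancelling the positive factor [s^(N+1)], with [s = (x / PI)^2], reduces both inequalities to
     comparing [c * P] with [2 * remainder N s]. *)
  assert (Hcmp : forall c x, 0 < x < PI / 2 ->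
    (c * x ^ (2 * N + 2) < Fdiff B N x <-> c * P < 2 * remainder N ((x / PI) ^ 2)) /\
    (Fdiff B N x < c * x ^ (2 * N + 2) <-> 2 * remainder N ((x / PI) ^ 2) < c * P)).
  { intros c x Hx. rewrite Fdiff_eq, Hpow by assumption.
    assert (Hq : 0 < ((x / PI) ^ 2) ^ S N) by (apply pow_lt, Hs, Hx).
    set (q := ((x / PI) ^ 2) ^ S N) in *. clearbody q.
    replace (c * (P * q)) with (q * (c * P)) by ring.
    replace (2 * q * remainder N ((x / PI) ^ 2))
      with (q * (2 * remainder N ((x / PI) ^ 2))) by ring.
    repeat split; intros H; (now apply Rmult_lt_compat_l) || (now apply Rmult_lt_reg_l in H). }
  assert (Hx : forall s, 0 < s < 1 / 4 -> exists x, 0 < x < PI / 2 /\ (x / PI) ^ 2 = s).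
  { intros s H. pose proof (sqrt_lt_R0 s ltac:(lra)) as Hq.
    assert (sqrt s < 1 / 2).
    { replace (1 / 2) with (sqrt ((1 / 2) ^ 2)) by (apply sqrt_pow2; lra).
      apply sqrt_lt_1; simpl; lra. }
    exists (sqrt s * PI). split; [nra|].
    replace (sqrt s * PI / PI) with (sqrt s) by (field; lra). apply pow2_sqrt. lra. }
  split; [|split].
  - assert (Hpos : forall x, 0 < x < PI / 2 ->
      aN * x ^ (2 * N + 2) < Fdiff B N x < bN * x ^ (2 * N + 2)).
    { intros x Hx0. pose proof (Hs x Hx0). split; apply Hcmp; try exact Hx0.
      - rewrite Ea. apply Rmult_lt_compat_l, remainder_increasing; lra.
      - rewrite Eb. apply Rmult_lt_compat_l, remainder_increasing; lra. }
    intros x Hx0. destruct (Rle_lt_dec 0 x) as [H0|H0].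
    + rewrite Rabs_pos_eq in Hx0 by exact H0. now apply Hpos.
    + rewrite Rabs_left in Hx0 by exact H0. pose proof (Hpos _ Hx0) as H.
      rewrite Fdiff_opp in H.
      * replace ((- x) ^ (2 * N + 2)) with (x ^ (2 * N + 2)) in H; [exact H|].
        rewrite !Hpow. do 2 f_equal. field. lra.
      * pose proof (sin_gt_0 (- x) ltac:(lra) ltac:(lra)) as Hsin. rewrite sin_neg in Hsin. lra.
      * pose proof (tan_gt_0 (- x) ltac:(lra) ltac:(lra)) as Htan. rewrite tan_neg in Htan. lra.
  - intros a Ha. apply (Rmult_le_reg_r P); [exact HP|]. rewrite Ea.
    (* [s] tends to [0], that is [x] to [0]; the Lipschitz bound makes the error linear in [s]. *)
    apply (le_of_lt_add_linear _ _ (2 * (4 / 3 * poles N (1 / 4)))). intros s Hs0.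
    destruct (Hx s Hs0) as (x & Hx0 & <-).
    pose proof (proj1 (proj1 (Hcmp a x Hx0)) (Ha x ltac:(rewrite Rabs_pos_eq; lra))).
    pose proof (remainder_lipschitz N 0 ((x / PI) ^ 2) ltac:(lra) ltac:(lra)). lra.
  - intros b Hb. apply (Rmult_le_reg_r P); [exact HP|]. rewrite Eb.
    apply (le_of_lt_add_linear _ _ (2 * (4 / 3 * poles N (1 / 4)))). intros s Hs0.
    (* Here [s] is the distance to the right endpoint [1 / 4], which corresponds to [x = PI / 2]. *)
    destruct (Hx (1 / 4 - s) ltac:(lra)) as (x & Hx0 & Ex).
    pose proof (proj1 (proj2 (Hcmp b x Hx0)) (Hb x ltac:(rewrite Rabs_pos_eq; lra))) as H.
    rewrite Ex in H.
    pose proof (remainder_lipschitz N (1 / 4 - s) (1 / 4) ltac:(lra) ltac:(lra)). lra.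
Qed.
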